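(* Consider a region discretized by the FDTD-Q scheme described in the context, with $0<\Delta t<\Delta t_{\mathrm{CFL,gen}}=2/\rho\!\left(\frac{1}{\hbar}(D_V'')^{-1/2}H(D_V'')^{-1/2}\right)$ ($\rho$ the spectral radius), and assume that the total probability is bounded above by a finite value $\mathcal{P}_{\max}$: $\mathcal{P}^n\le\mathcal{P}_{\max}$ for $n=0,1,\dots,n_t$. Then $$\mathcal{H}^n\ge\Delta x\Delta y\Delta z\,\frac{\mathcal{P}_{\max}}{\lambda_{\min}(\mathbf{P})}\left(\min\Big(\min_{i,j,k}U_{i,j,k},\,0\Big)-\frac{4\hbar}{\Delta t}\right),\qquad n=1,2,\dots,n_t-1,$$ where $\lambda_{\min}$ denotes the smallest eigenvalue, and $$\frac{\mathcal{H}^{n+1}-\mathcal{H}^n}{\Delta t}=s^{n+\frac12},\qquad n=1,2,\dots,n_t-2.$$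
   Context: Fix constants $\hbar>0$, $m>0$, cell sizes $\Delta x,\Delta y,\Delta z>0$, positive integers $n_x,n_y,n_z,n_t$ and a time step $\Delta t>0$. The region is a box made of $n_x\times n_y\times n_z$ primary cells of size $\Delta x\times\Delta y\times\Delta z$, with primary nodes $(i,j,k)$, $1\le i\le n_x+1$, $1\le j\le n_y+1$, $1\le k\le n_z+1$. Let $N=(n_x+1)(n_y+1)(n_z+1)$; vectors indexed by nodes use the ordering $i+(j-1)(n_x+1)+(k-1)(n_x+1)(n_y+1)$. Real potential values $U_{i,j,k}$ are given at the nodes; $D_U$ is the $N\times N$ diagonal matrix containing them. Let $I_p$ be the $p\times p$ identity, $\tilde I_p=\mathrm{diag}(\tfrac12,1,\dots,1,\tfrac12)$ ($p\times p$), $W_p=[0_{p\times1}\ I_p]-[I_p\ 0_{p\times 1}]$ ($p\times(p+1)$), $\otimes$ the Kronecker product, and $e\{p,q\}$ the $q\times 1$ vector with $1$ in position $p$ and zeros elsewhere. Define $D_V''=\Delta x\Delta y\Delta z\,\tilde I_{n_z+1}\otimes\tilde I_{n_y+1}\otimes\tilde I_{n_x+1}$; $D=[D_x\ D_y\ D_z]$ with $D_x=-I_{n_z+1}\otimes I_{n_y+1}\otimes W_{n_x}^T$, $D_y=-I_{n_z+1}\otimes W_{n_y}^T\otimes I_{n_x+1}$, $D_z=-W_{n_z}^T\otimes I_{n_y+1}\otimes I_{n_x+1}$; $D_S''=\mathrm{diag}(\Delta y\Delta z\,\tilde I_{n_z+1}\otimes\tilde I_{n_y+1}\otimes I_{n_x},\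 \Delta x\Delta z\,\tilde I_{n_z+1}\otimes I_{n_y}\otimes\tilde I_{n_x+1},\ \Delta x\Delta y\,I_{n_z}\otimes\tilde I_{n_y+1}\otimes\tilde I_{n_x+1})$; $D_l'=\mathrm{diag}(\Delta x\, I_{n_x(n_y+1)(n_z+1)},\ \Delta y\, I_{(n_x+1)n_y(n_z+1)},\ \Delta z\, I_{(n_x+1)(n_y+1)n_z})$; $H=\frac{\hbar^2}{2m}D D_S''(D_l')^{-1}D^T+D_V''D_U$; $\mathbf{P}=\begin{bmatrix}D_V''&-\frac{\Delta t}{2\hbar}H\\-\frac{\Delta t}{2\hbar}H&D_V''\end{bmatrix}$. Boundary (''hanging'') variables: $L=[L_W\ L_E\ L_S\ L_N\ L_B\ L_T]$ with $L_W=I_{n_z+1}\otimes I_{n_y+1}\otimes e\{1,n_x+1\}$, $L_E=I_{n_z+1}\otimes I_{n_y+1}\otimes e\{n_x+1,n_x+1\}$, $L_S=I_{n_z+1}\otimes e\{1,n_y+1\}\otimes I_{n_x+1}$, $L_N=I_{n_z+1}\otimes e\{n_y+1,n_y+1\}\otimes I_{n_x+1}$, $L_B=e\{1,n_z+1\}\otimes I_{n_y+1}\otimes I_{n_x+1}$, $L_T=e\{n_z+1,n_z+1\}\otimes I_{n_y+1}\otimes I_{n_x+1}$; let $M$ be the number of columns of $L$. $D_{\hat n}=\mathrm{diag}(-I_{(n_y+1)(n_z+1)},I_{(n_y+1)(n_z+1)},-I_{(n_x+1)(n_z+1)},I_{(n_x+1)(n_z+1)},-I_{(n_x+1)(n_y+1)},I_{(n_x+1)(n_y+1)})$;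 $D_{S,b}''=\mathrm{diag}(\Delta y\Delta z\,\tilde I_{n_z+1}\otimes\tilde I_{n_y+1},\ \Delta y\Delta z\,\tilde I_{n_z+1}\otimes\tilde I_{n_y+1},\ \Delta x\Delta z\,\tilde I_{n_z+1}\otimes\tilde I_{n_x+1},\ \Delta x\Delta z\,\tilde I_{n_z+1}\otimes\tilde I_{n_x+1},\ \Delta x\Delta y\,\tilde I_{n_y+1}\otimes\tilde I_{n_x+1},\ \Delta x\Delta y\,\tilde I_{n_y+1}\otimes\tilde I_{n_x+1})$; $H_\perp=\frac{\hbar^2}{2m}L D_{\hat n}D_{S,b}''$. FDTD-Q scheme: real vectors $\psi_R^n\in\mathbb{R}^N$ and $\psi_I^{n-\frac12}\in\mathbb{R}^N$ ($n=0,\dots,n_t$), and arbitrary boundary vectors $g_R^n\in\mathbb{R}^M$, $g_I^{n+\frac12}\in\mathbb{R}^M$ ($n=0,\dots,n_t-1$), satisfying for $n=0,\dots,n_t-1$: $\hbar D_V''\frac{\psi_R^{n+1}-\psi_R^n}{\Delta t}=H\psi_I^{n+\frac12}-H_\perp g_I^{n+\frac12}$ and $\hbar D_V''\frac{\psi_I^{n+\frac12}-\psi_I^{n-\frac12}}{\Delta t}=-H\psi_R^n+H_\perp g_R^n$. Let $\psi^n=\begin{bmatrix}\psi_R^n\\ \psi_I^{n-\frac12}\end{bmatrix}$. Total probability: $\mathcal{P}^n=(\psi^n)^T\mathbf{P}\psi^n$, $n=0,\dots,n_t$. Total energy, for $n=1,\dots,n_t-1$: $\mathcal{H}^n=(\psi_R^n)^TH\psi_R^n+(\psi_I^{n-\frac12})^TH\psi_I^{n-\frac12}+\Delta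 t\left(\frac{\psi_R^n-\psi_R^{n-1}}{\Delta t}\right)^T(\hbar D_V'')\frac{\psi_I^{n+\frac12}-\psi_I^{n-\frac12}}{\Delta t}$. Supplied power, for $n=1,\dots,n_t-2$: $s^{n+\frac12}=2\left(\frac{\psi_R^{n+1}-\psi_R^n}{\Delta t}\right)^TH_\perp\frac{g_R^{n+1}+g_R^n}{2}+2\left(\frac{\psi_I^{n+\frac12}-\psi_I^{n-\frac12}}{\Delta t}\right)^TH_\perp\frac{g_I^{n+\frac12}+g_I^{n-\frac12}}{2}$. *)

(* Defs.v *)
From HB Require Import structures.
From mathcomp Require Import all_boot all_order all_algebra.
From mathcomp Require Import mxtens complex.
From mathcomp Require Import classical_sets reals.
Unset Printing Implicit Defensive.
Import Order.TTheory GRing.Theory Num.Theory.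
Local Open Scope ring_scope.
Local Open Scope classical_set_scope.

Definition Itl {R : realType} (p : nat) : 'M[R]_p :=
  \matrix_(i, j) (if i == j then
                    (if ((i : nat) == 0%N) || ((i : nat) == p.-1) then 2^-1 else 1)
                  else 0).

Definition Wmx {R : realType} (p : nat) : 'M[R]_(p, p.+1) :=
  \matrix_(i < p, j < p.+1) (((j : nat) == i.+1)%:R - ((j : nat) == i)%:R).

(* e{p,q}: q x 1 column vector with a 1 in (1-based) position p *)
Definition evec {R : realType} (p q : nat) : 'cV[R]_q :=
  \col_(i < q) ((i : nat) == p.-1)%:R.

Definition bdiag {R : realType} {m n : nat} (A : 'M[R]_m) (B : 'M[R]_n)
  : 'M[R]_(m + n) := block_mx A 0 0 B.

(* A^{-1/2} for a diagonal matrix A with positive diagonal entries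
   (only used for A = D_V'', which is diagonal and positive) *)
Definition diag_inv_sqrt {R : realType} {n : nat} (A : 'M[R]_n) : 'M[R]_n :=
  \matrix_(i, j) (if i == j then (Num.sqrt (A i i))^-1 else 0).

Definition specrad {R : realType} {n : nat} (A : 'M[R]_n) : R :=
  sup [set r : R | exists l : R[i],
         eigenvalue (map_mx (fun x => (x%:C)%C) A) l /\ `|l| = (r%:C)%C].

(* smallest eigenvalue (used for real symmetric matrices, whose
   eigenvalues are all real) *)
Definition lambda_min {R : realType} {n : nat} (A : 'M[R]_n) : R :=
  inf [set l : R | eigenvalue A l].

Definition Nn (nx ny nz : nat) : nat := (nz.+1 * (ny.+1 * nx.+1))%N.
Definition MWE (nx ny nz : nat) : nat := (nz.+1 * (ny.+1 * 1))%N.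
Definition MSN (nx ny nz : nat) : nat := (nz.+1 * (1 * nx.+1))%N.
Definition MBT (nx ny nz : nat) : nat := (1 * (ny.+1 * nx.+1))%N.
Definition Mb (nx ny nz : nat) : nat :=
  (MWE nx ny nz + (MWE nx ny nz + (MSN nx ny nz + (MSN nx ny nz
     + (MBT nx ny nz + MBT nx ny nz)))))%N.

Section Mats.
Local Notation "A ⊗ B" := (tensmx A B) (at level 40, left associativity).

Definition DVpp {R : realType} (nx ny nz : nat) (dx dy dz : R)
  : 'M[R]_(Nn nx ny nz) :=
  (dx * dy * dz) *: (Itl nz.+1 ⊗ (Itl ny.+1 ⊗ Itl nx.+1)).

Definition Dx {R : realType} (nx ny nz : nat)
  : 'M[R]_(Nn nx ny nz, nz.+1 * (ny.+1 * nx)) :=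
  - ((1%:M : 'M[R]_nz.+1) ⊗ ((1%:M : 'M[R]_ny.+1) ⊗ (Wmx nx)^T)).
Definition Dy {R : realType} (nx ny nz : nat)
  : 'M[R]_(Nn nx ny nz, nz.+1 * (ny * nx.+1)) :=
  - ((1%:M : 'M[R]_nz.+1) ⊗ ((Wmx ny)^T ⊗ (1%:M : 'M[R]_nx.+1))).
Definition Dz {R : realType} (nx ny nz : nat)
  : 'M[R]_(Nn nx ny nz, nz * (ny.+1 * nx.+1)) :=
  - ((Wmx nz)^T ⊗ ((1%:M : 'M[R]_ny.+1) ⊗ (1%:M : 'M[R]_nx.+1))).

Definition Dmx {R : realType} (nx ny nz : nat) :=
  row_mx (@Dx R nx ny nz) (row_mx (@Dy R nx ny nz) (@Dz R nx ny nz)).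

Definition DSpp {R : realType} (nx ny nz : nat) (dx dy dz : R) :=
  bdiag ((dy * dz) *: (Itl nz.+1 ⊗ (Itl ny.+1 ⊗ (1%:M : 'M[R]_nx))))
   (bdiag ((dx * dz) *: (Itl nz.+1 ⊗ ((1%:M : 'M[R]_ny) ⊗ Itl nx.+1)))
          ((dx * dy) *: ((1%:M : 'M[R]_nz) ⊗ (Itl ny.+1 ⊗ Itl nx.+1)))).

Definition Dlp {R : realType} (nx ny nz : nat) (dx dy dz : R) :=
  bdiag (dx *: (1%:M : 'M[R]_(nz.+1 * (ny.+1 * nx))))
   (bdiag (dy *: (1%:M : 'M[R]_(nz.+1 * (ny * nx.+1))))
          (dz *: (1%:M : 'M[R]_(nz * (ny.+1 * nx.+1))))).

Definition DUmx {R : realType} {nx ny nz : nat} (U : 'cV[R]_(Nn nx ny nz))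
  : 'M[R]_(Nn nx ny nz) := diag_mx U^T.

Definition Hmx {R : realType} (nx ny nz : nat) (hbar m dx dy dz : R)
  (U : 'cV[R]_(Nn nx ny nz)) : 'M[R]_(Nn nx ny nz) :=
  (hbar ^+ 2 / (2 * m)) *:
    (Dmx nx ny nz *m DSpp nx ny nz dx dy dz *m invmx (Dlp nx ny nz dx dy dz)
       *m (Dmx nx ny nz)^T)
  + DVpp nx ny nz dx dy dz *m DUmx U.

Definition Pmx {R : realType} (nx ny nz : nat) (hbar m dx dy dz dt : R)
  (U : 'cV[R]_(Nn nx ny nz)) : 'M[R]_(Nn nx ny nz + Nn nx ny nz) :=
  block_mx (DVpp nx ny nz dx dy dz) (- (dt / (2 * hbar)) *: Hmx nx ny nz hbar m dx dy dz U)
           (- (dt / (2 * hbar)) *: Hmx nx ny nz hbar m dx dy dz U) (DVpp nx ny nz dx dy dz).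

(* boundary selection matrix L = [L_W L_E L_S L_N L_B L_T] *)
Definition Lmx {R : realType} (nx ny nz : nat) : 'M[R]_(Nn nx ny nz, Mb nx ny nz) :=
  row_mx ((1%:M : 'M[R]_nz.+1) ⊗ ((1%:M : 'M[R]_ny.+1) ⊗ evec 1 nx.+1))
 (row_mx ((1%:M : 'M[R]_nz.+1) ⊗ ((1%:M : 'M[R]_ny.+1) ⊗ evec nx.+1 nx.+1))
 (row_mx ((1%:M : 'M[R]_nz.+1) ⊗ (evec 1 ny.+1 ⊗ (1%:M : 'M[R]_nx.+1)))
 (row_mx ((1%:M : 'M[R]_nz.+1) ⊗ (evec ny.+1 ny.+1 ⊗ (1%:M : 'M[R]_nx.+1)))
 (row_mx (evec 1 nz.+1 ⊗ ((1%:M : 'M[R]_ny.+1) ⊗ (1%:M : 'M[R]_nx.+1)))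
         (evec nz.+1 nz.+1 ⊗ ((1%:M : 'M[R]_ny.+1) ⊗ (1%:M : 'M[R]_nx.+1))))))).

Definition Dnhat {R : realType} (nx ny nz : nat) : 'M[R]_(Mb nx ny nz) :=
  bdiag (- 1%:M : 'M[R]_(MWE nx ny nz)) (bdiag (1%:M : 'M[R]_(MWE nx ny nz))
 (bdiag (- 1%:M : 'M[R]_(MSN nx ny nz)) (bdiag (1%:M : 'M[R]_(MSN nx ny nz))
 (bdiag (- 1%:M : 'M[R]_(MBT nx ny nz)) (1%:M : 'M[R]_(MBT nx ny nz)))))).

(* dimension identifications (the blocks of L have these column counts) *)
Definition eWE (nx ny nz : nat) : (nz.+1 * ny.+1 = MWE nx ny nz)%N :=
  congr1 (muln nz.+1) (esym (muln1 ny.+1)).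
Definition eSN (nx ny nz : nat) : (nz.+1 * nx.+1 = MSN nx ny nz)%N :=
  congr1 (muln nz.+1) (esym (mul1n nx.+1)).
Definition eBT (nx ny nz : nat) : (ny.+1 * nx.+1 = MBT nx ny nz)%N :=
  esym (mul1n (ny.+1 * nx.+1)).

Definition DSbpp {R : realType} (nx ny nz : nat) (dx dy dz : R)
  : 'M[R]_(Mb nx ny nz) :=
  let W := (dy * dz) *: castmx (eWE nx ny nz, eWE nx ny nz)
                                (Itl nz.+1 ⊗ Itl ny.+1) in
  let S := (dx * dz) *: castmx (eSN nx ny nz, eSN nx ny nz)
                                (Itl nz.+1 ⊗ Itl nx.+1) in
  let B := (dx * dy) *: castmx (eBT nx ny nz, eBT nx ny nz)
                                (Itl ny.+1 ⊗ Itl nx.+1) in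
  bdiag W (bdiag W (bdiag S (bdiag S (bdiag B B)))).

Definition Hperp {R : realType} (nx ny nz : nat) (hbar m dx dy dz : R)
  : 'M[R]_(Nn nx ny nz, Mb nx ny nz) :=
  (hbar ^+ 2 / (2 * m)) *: (Lmx nx ny nz *m Dnhat nx ny nz *m DSbpp nx ny nz dx dy dz).

End Mats.

(* Indexing conventions:
     psiR n = psi_R^n,         psiI n = psi_I^{n-1/2},
     gR n   = g_R^n,           gI n   = g_I^{n+1/2}. *)
Definition fdtdq_scheme {R : realType} (nx ny nz nt : nat) (hbar m dx dy dz dt : R)
  (U : 'cV[R]_(Nn nx ny nz)) (psiR psiI : nat -> 'cV[R]_(Nn nx ny nz))
  (gR gI : nat -> 'cV[R]_(Mb nx ny nz)) : Prop :=
  forall n : nat, (n < nt)%N ->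
    hbar *: DVpp nx ny nz dx dy dz *m (dt^-1 *: (psiR n.+1 - psiR n))
      = Hmx nx ny nz hbar m dx dy dz U *m psiI n.+1 - Hperp nx ny nz hbar m dx dy dz *m gI n
 /\ hbar *: DVpp nx ny nz dx dy dz *m (dt^-1 *: (psiI n.+1 - psiI n))
      = - (Hmx nx ny nz hbar m dx dy dz U *m psiR n) + Hperp nx ny nz hbar m dx dy dz *m gR n.

Definition total_prob {R : realType} (nx ny nz : nat) (hbar m dx dy dz dt : R)
  (U : 'cV[R]_(Nn nx ny nz)) (psiR psiI : nat -> 'cV[R]_(Nn nx ny nz)) (n : nat) : R :=
  let psi := col_mx (psiR n) (psiI n) in
  (psi^T *m Pmx nx ny nz hbar m dx dy dz dt U *m psi) ord0 ord0.

(* total energy H^n (meaningful for 1 <= n <= n_t - 1) *)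
Definition total_energy {R : realType} (nx ny nz : nat) (hbar m dx dy dz dt : R)
  (U : 'cV[R]_(Nn nx ny nz)) (psiR psiI : nat -> 'cV[R]_(Nn nx ny nz)) (n : nat) : R :=
  ((psiR n)^T *m Hmx nx ny nz hbar m dx dy dz U *m psiR n) ord0 ord0
  + ((psiI n)^T *m Hmx nx ny nz hbar m dx dy dz U *m psiI n) ord0 ord0
  + dt * ((dt^-1 *: (psiR n - psiR n.-1))^T *m (hbar *: DVpp nx ny nz dx dy dz)
            *m (dt^-1 *: (psiI n.+1 - psiI n))) ord0 ord0.

(* supplied power s^{n+1/2} (meaningful for 1 <= n <= n_t - 2) *)
Definition supplied_power {R : realType} (nx ny nz : nat) (hbar m dx dy dz dt : R)
  (psiR psiI : nat -> 'cV[R]_(Nn nx ny nz)) (gR gI : nat -> 'cV[R]_(Mb nx ny nz))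
  (n : nat) : R :=
  2 * ((dt^-1 *: (psiR n.+1 - psiR n))^T *m Hperp nx ny nz hbar m dx dy dz
         *m (2^-1 *: (gR n.+1 + gR n))) ord0 ord0
  + 2 * ((dt^-1 *: (psiI n.+1 - psiI n))^T *m Hperp nx ny nz hbar m dx dy dz
         *m (2^-1 *: (gI n + gI n.-1))) ord0 ord0.

(* Main.v *)
(** The CFL condition says that the symmetric matrix
    [V^(-1/2) H V^(-1/2) / hbar] (with [V = D_V'']) has all its eigenvalues
    strictly between [-2/dt] and [2/dt]; hence [P] is positive definite and
    [|psi_R|^2 + |psi_I|^2 <= Pmax / lambda_min P] at every time step.  As
    [H = V D_U] plus a positive semidefinite kinetic part and
    [V <= dx dy dz], the two quadratic terms of the energy give the
    [min (min U) 0] part of the bound, and the mixed term, by AM-GM, the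
    [4 hbar / dt] part.  The power balance is a summation by parts in time:
    both scheme equations are tested against the increments of the other
    field, and the terms in [H] cancel. *)
Require Import Defs.
From HB Require Import structures.
From mathcomp Require Import all_boot all_order all_algebra.
From mathcomp Require Import mxtens complex spectral sesquilinear ring lra.
From mathcomp Require Import boolp classical_sets reals.
Import Order.TTheory GRing.Theory Num.Theory.
Local Open Scope ring_scope.
Set Implicit Arguments.
Unset Strict Implicit.

(** * Bilinear forms and Rayleigh quotients *)

Definition bform {R : realType} {p q : nat} (x : 'cV[R]_p) (A : 'M[R]_(p, q))
  (y : 'cV[R]_q) : R := (x^T *m A *m y) ord0 ord0.

Definition sqnorm {R : realType} {p : nat} (x : 'cV[R]_p) : R :=
  \sum_i x i ord0 ^+ 2.

Section BilinearForm.
Variables (R : realType) (p q : nat).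
Implicit Types (x : 'cV[R]_p) (y : 'cV[R]_q) (A : 'M[R]_(p, q)) (c : R).

Lemma bformDl x1 x2 A y : bform (x1 + x2) A y = bform x1 A y + bform x2 A y.
Proof. by rewrite /bform linearD /= !mulmxDl mxE. Qed.

Lemma bformDm x A1 A2 y : bform x (A1 + A2) y = bform x A1 y + bform x A2 y.
Proof. by rewrite /bform mulmxDr mulmxDl mxE. Qed.

Lemma bformDr x A y1 y2 : bform x A (y1 + y2) = bform x A y1 + bform x A y2.
Proof. by rewrite /bform mulmxDr mxE. Qed.

Lemma bformZl c x A y : bform (c *: x) A y = c * bform x A y.
Proof. by rewrite /bform linearZ /= -!scalemxAl mxE. Qed.

Lemma bformZm c x A y : bform x (c *: A) y = c * bform x A y.
Proof. by rewrite /bform -scalemxAr -scalemxAl mxE. Qed.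

Lemma bformZr c x A y : bform x A (c *: y) = c * bform x A y.
Proof. by rewrite /bform -scalemxAr mxE. Qed.

Lemma bformNl x A y : bform (- x) A y = - bform x A y.
Proof. by rewrite -scaleN1r bformZl mulN1r. Qed.

Lemma bformNm x A y : bform x (- A) y = - bform x A y.
Proof. by rewrite -scaleN1r bformZm mulN1r. Qed.

Lemma bformNr x A y : bform x A (- y) = - bform x A y.
Proof. by rewrite -scaleN1r bformZr mulN1r. Qed.

Lemma bformT x A y : bform x A y = bform y A^T x.
Proof.
rewrite /bform -[in RHS](trmxK x) -!trmx_mul [RHS]mxE.
by rewrite mulmxA.
Qed.

End BilinearForm.

Lemma bform_mul {R : realType} {p q r : nat} (x : 'cV[R]_p) (A : 'M[R]_(p, q))
  (B : 'M[R]_(q, r)) (y : 'cV[R]_r) : bform x (A *m B) y = bform x A (B *m y).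
Proof. by rewrite /bform !mulmxA. Qed.

Lemma bform_mulT {R : realType} {p q r : nat} (x : 'cV[R]_p) (A : 'M[R]_(p, q))
  (B : 'M[R]_(q, r)) (y : 'cV[R]_r) : bform x (A *m B) y = bform (A^T *m x) B y.
Proof. by rewrite /bform trmx_mul trmxK !mulmxA. Qed.

Lemma bform_block {R : realType} {p1 p2 q1 q2 : nat} (x1 : 'cV[R]_p1)
  (x2 : 'cV[R]_p2) (A : 'M[R]_(p1, q1)) (B : 'M[R]_(p1, q2)) (C : 'M[R]_(p2, q1))
  (D : 'M[R]_(p2, q2)) (y1 : 'cV[R]_q1) (y2 : 'cV[R]_q2) :
  bform (col_mx x1 x2) (block_mx A B C D) (col_mx y1 y2)
  = bform x1 A y1 + bform x1 B y2 + (bform x2 C y1 + bform x2 D y2).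
Proof.
rewrite /bform tr_col_mx mul_row_block mul_row_col !mulmxDl.
by rewrite [LHS]mxE [X in X + _]mxE [X in _ + X]mxE addrACA.
Qed.

(* Linearity in the matrix is left out: matching it against [bform x (DVpp ..) y]
   or [bform x (Hmx ..) y] would unfold the matrix. *)
Definition bformE := (bformDl, bformDr, bformNl, bformNr, bformZl, bformZr).

Section SquaredNorm.
Variable R : realType.

Lemma sqnorm_ge0 {p} (x : 'cV[R]_p) : 0 <= sqnorm x.
Proof. by apply: sumr_ge0 => i _; exact: sqr_ge0. Qed.

Lemma sqnorm_gt0 {p} (x : 'cV[R]_p) : x != 0 -> 0 < sqnorm x.
Proof.
move=> x0; rewrite lt_def sqnorm_ge0 andbT; apply: contraNneq x0.
move/eqP; rewrite psumr_eq0 => [|i _]; last exact: sqr_ge0.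
move=> /allP z; apply/eqP/colP => i; rewrite mxE.
by have := z i (mem_index_enum i); rewrite /= sqrf_eq0 => /eqP.
Qed.

Lemma sqnormE {p} (x : 'cV[R]_p) : sqnorm x = bform x 1%:M x.
Proof.
rewrite /bform mulmx1 mxE; apply: eq_bigr => i _.
by rewrite mxE expr2.
Qed.

Lemma sqnorm_col_mx {p q} (x : 'cV[R]_p) (y : 'cV[R]_q) :
  sqnorm (col_mx x y) = sqnorm x + sqnorm y.
Proof.
rewrite /sqnorm big_split_ord /=; congr (_ + _); apply: eq_bigr => i _.
  by rewrite col_mxEu.
by rewrite col_mxEd.
Qed.

Lemma parallelogram {p} (x y : 'cV[R]_p) :
  sqnorm (x + y) + sqnorm (x - y) = 2 * (sqnorm x + sqnorm y).
Proof. rewrite !sqnormE !bformE; ring. Qed.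

End SquaredNorm.

Section Rayleigh.
Variables (R : realType) (p : nat) (S : 'M[R]_p).
Hypothesis S_sym : S^T = S.

(** The complexification of [S] is Hermitian, so a unitary basis of eigenvectors turns the form into
    a sum of eigenvalues times squared moduli. It suffices that [c] bounds the real eigenvalues,
    since a Hermitian matrix has no others. *)
Lemma rayleigh_ge c : (forall l, eigenvalue S l -> c <= l) ->
  forall x, c * sqnorm x <= bform x S x.
Proof.
move=> cle x.
pose A := map_mx (real_complex R) S; pose P := spectralmx A.
pose d := spectral_diag A.
have Aherm : A \is hermsymmx.
  apply: realsym_hermsym.
    by apply/is_hermitianmxP; rewrite expr0 scale1r map_mx_id // map_trmx S_sym.
  by apply/mxOverP => i j; rewrite mxE; apply/complex_realP; exists (S i j).
have PU : P \is unitarymx by exact: spectral_unitarymx.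
have AE : A = invmx P *m diag_mx d *m P.
  exact/orthomx_spectralP/hermitian_normalmx.
(* Row [i] of the unitary matrix [P] is a left eigenvector for the real number [d ord0 i];
   [eigenvalue_map] brings this eigenvalue down from the complexification to [S]. *)
have dge i : (c%:C)%C <= d ord0 i.
  have /complex_realP[r rE] : d ord0 i \is Num.real.
    by move/hermitian_spectral_diag_real/mxOverP: Aherm; apply.
  rewrite rE lecR; apply: cle.
  rewrite -(eigenvalue_map (real_complex R)) -/A; apply/eigenvalueP.
  exists (row i P).
    rewrite {1}AE !mulmxA -row_mul mulmxV ?spectral_unit // row1.
    by rewrite -rowE row_diag_mx rE -scalemxAl -rowE.
  rewrite rowE mulmx_free_eq0 ?row_free_unit ?spectral_unit //.
  by apply/eqP => /rowP/(_ i)/eqP; rewrite !mxE !eqxx oner_eq0.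
pose z := map_mx (real_complex R) x; pose y := P *m z.
(* Since [x] is real, conjugation fixes [z]. *)
have zE : z^T *m (P ^t*)%sesqui = (y ^t*)%sesqui.
  rewrite /y trmx_mul map_mxM; congr (_ *m _).
  apply/matrixP => i j; rewrite !mxE; symmetry; apply/CrealP/complex_realP.
  by exists (x j i).
have formE (e : 'rV_p) : (z^T *m ((P ^t*)%sesqui *m diag_mx e *m P) *m z) ord0 ord0
    = \sum_i e ord0 i * `|y i ord0| ^+ 2.
  rewrite !mulmxA zE -mulmxA -/y mul_mx_diag mxE.
  by apply: eq_bigr => i _; rewrite 3!mxE normCK -mulrA mulrCA (mulrC (y i ord0)).
have Sx : ((bform x S x)%:C)%C = \sum_i d ord0 i * `|y i ord0| ^+ 2.
  rewrite -formE -invmx_unitary // -AE /bform /A /z.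
  by rewrite map_trmx -!map_mxM [RHS]mxE.
(* As [P] is unitary, the expansion [formE] also applies to the identity, with the constant diagonal
   1 in place of [d]. *)
have nx : ((sqnorm x)%:C)%C = \sum_i `|y i ord0| ^+ 2.
  transitivity ((z^T *m 1%:M *m z) ord0 ord0).
    by rewrite sqnormE /bform /z map_trmx -(map_mx1 (real_complex R)) -!map_mxM [RHS]mxE.
  rewrite -(mulVmx (unitarymx_unit PU)) invmx_unitary //.
  rewrite -[in X in X *m P](mulmx1 (P ^t*)%sesqui).
  rewrite -diag_const_mx formE.
  by apply: eq_bigr => i _; rewrite mxE mul1r.
rewrite -lecR rmorphM /= nx Sx mulr_sumr; apply: ler_sum => i _.
by rewrite ler_wpM2r // exprn_ge0.
Qed.

End Rayleigh.

(** * Spectral radius and smallest eigenvalue *)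

Section ExtremeEigenvalues.
Variable R : realType.

(** The bound is the sum of the moduli of all roots of the characteristic polynomial. It makes the
    set under the [sup] of [specrad] bounded above. *)
Lemma eigenvalue_norm_bounded {p} (A : 'M[R[i]]_p) :
  exists B : R, forall l, eigenvalue A l -> `|l| <= (B%:C)%C.
Proof.
have [rs rsE] := closed_field_poly_normal (char_poly A).
have /complex_realP[B BE] : \sum_(z <- rs) `|z| \is Num.real.
  by apply: rpred_sum => z _; exact: normr_real.
exists B => l; rewrite eigenvalue_root_char rsE.
rewrite rootZ ?lead_coef_eq0 ?monic_neq0 ?char_poly_monic //.
rewrite root_prod_XsubC -BE => lrs.
by rewrite (big_rem l lrs) /= lerDl sumr_ge0.
Qed.

Lemma eigenvalue_le_specrad {p} (A : 'M[R]_p) l :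
  eigenvalue A l -> `|l| <= specrad A.
Proof.
move=> lA; apply: ub_le_sup.
  have [B Bub] := eigenvalue_norm_bounded (map_mx (real_complex R) A).
  by exists B => r [z [/Bub zB zr]]; rewrite -lecR -zr.
exists (l%:C)%C; split; first by rewrite (eigenvalue_map (real_complex R)).
by rewrite normc_def /= expr0n /= addr0 sqrtr_sqr.
Qed.

Variables (p : nat) (S : 'M[R]_p).
Hypothesis S_sym : S^T = S.

(** Polarization: the values of the form at [x + y] and [x - y] differ by four times [bform x S y].
    Each is controlled by the spectral radius, and the parallelogram law adds up the two norms. *)
Lemma sym_bform_le_specrad x y :
  2 * bform x S y <= specrad S * (sqnorm x + sqnorm y).
Proof.
have lb z : - specrad S * sqnorm z <= bform z S z.
  apply: rayleigh_ge => // l /eigenvalue_le_specrad.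
  by rewrite ler_norml => /andP[].
(* The upper bound is the lower bound for [- S], whose eigenvalues are the opposite ones. *)
have ub z : bform z S z <= specrad S * sqnorm z.
  rewrite -lerN2 -mulNr -bformNm; apply: rayleigh_ge => [|l].
    by rewrite linearN /= S_sym.
  move=> /eigenvalueP[v vS v0].
  rewrite lerNl (le_trans (ler_norm _)) // eigenvalue_le_specrad //.
  apply/eigenvalueP; exists v => //.
  by rewrite -[S]opprK mulmxN vS scaleNr.
have par := parallelogram x y.
have := lb (x - y); have := ub (x + y).
have -> : sqnorm (x + y) = 2 * (sqnorm x + sqnorm y) - sqnorm (x - y).
  by rewrite -par addrK.
rewrite !bformE (bformT y S x) S_sym.
nra.
Qed.

(** Testing the form on an eigenvector bounds each eigenvalue; [0 < p] ensures that the [inf] is not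
    taken over the empty set. *)
Lemma lambda_min_ge delta : (0 < p)%N ->
  (forall x, delta * sqnorm x <= bform x S x) -> delta <= lambda_min S.
Proof.
move=> p0 Sdelta; apply: lb_le_inf.
  (* Without eigenvalues, every constant would be a lower bound of the Rayleigh
     quotient. *)
  apply: contrapT => noev.
  have e_gt0 : 0 < sqnorm (const_mx 1 : 'cV[R]_p).
    apply: sqnorm_gt0; apply/eqP => /colP/(_ (Ordinal p0)).
    by rewrite !mxE => /eqP; rewrite oner_eq0.
  set e := const_mx 1 in e_gt0.
  have : (bform e S e / sqnorm e + 1) * sqnorm e <= bform e S e.
    by apply: rayleigh_ge => // l lS; case: noev; exists l.
  by rewrite mulrDl divfK ?gt_eqF // mul1r gerDl leNgt e_gt0.
move=> l /eigenvalueP[v vS v0].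
have v_gt0 : 0 < sqnorm v^T by apply: sqnorm_gt0; rewrite trmx_eq0.
rewrite -(ler_pM2r v_gt0) (le_trans (Sdelta _)) //.
by rewrite sqnormE /bform trmxK mulmx1 vS -scalemxAl mxE.
Qed.

(** The constant [delta] bounds the eigenvalues from below, so that their [inf] is a genuine lower
    bound and [rayleigh_ge] applies to it. *)
Lemma lambda_min_le delta x :
  (forall y, delta * sqnorm y <= bform y S y) ->
  lambda_min S * sqnorm x <= bform x S x.
Proof.
move=> Sdelta; apply: rayleigh_ge => // l lS; apply: ge_inf => //.
exists delta => k /eigenvalueP[v vS v0].
have v_gt0 : 0 < sqnorm v^T by apply: sqnorm_gt0; rewrite trmx_eq0.
rewrite -(ler_pM2r v_gt0) (le_trans (Sdelta _)) //.
by rewrite sqnormE /bform trmxK mulmx1 vS -scalemxAl mxE.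
Qed.

End ExtremeEigenvalues.

(** * Nonnegative diagonal matrices *)

Section DiagonalMatrices.
Variable R : realType.

(** This class is closed under all the operations that build the weights of the scheme: scaling,
    Kronecker and matrix products, diagonal blocks and inversion. *)
Definition nneg_diag {p} (A : 'M[R]_p) :=
  is_diag_mx A /\ forall i, 0 <= A i i.

Lemma is_diag_mx_tens {p q} (A : 'M[R]_p) (B : 'M[R]_q) :
  is_diag_mx A -> is_diag_mx B -> is_diag_mx (tensmx A B).
Proof.
move=> /is_diag_mxP dA /is_diag_mxP dB; apply/is_diag_mxP => i j.
rewrite -(mxtens_unindexK i) -(mxtens_unindexK j).
case: (mxtens_unindex i) (mxtens_unindex j) => i1 i2 [j1 j2] ij.
rewrite tensmxE.
have [e1|n1] := eqVneq (i1 : nat) j1; last by rewrite dA ?mul0r.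
have [e2|n2] := eqVneq (i2 : nat) j2; last by rewrite dB ?mulr0.
by move: ij; rewrite (ord_inj e1) (ord_inj e2) eqxx.
Qed.

Lemma is_diag_mxZ {p} c (A : 'M[R]_p) : is_diag_mx A -> is_diag_mx (c *: A).
Proof.
by move=> /is_diag_mxP dA; apply/is_diag_mxP => i j ij; rewrite mxE dA ?mulr0.
Qed.

Lemma is_diag_mx_Itl p : is_diag_mx (Itl p : 'M[R]_p).
Proof.
by apply/is_diag_mxP => i j ij; rewrite mxE -val_eqE /= (negPf ij).
Qed.

Lemma nneg_diag1 p : nneg_diag (1%:M : 'M[R]_p).
Proof.
split; first exact: scalar_mx_is_diag.
by move=> i; rewrite mxE eqxx ler01.
Qed.

Lemma nneg_diagZ {p} c (A : 'M[R]_p) : 0 <= c -> nneg_diag A -> nneg_diag (c *: A).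
Proof.
move=> c0 [dA A0]; split=> [|i]; first exact: is_diag_mxZ.
by rewrite mxE mulr_ge0.
Qed.

Lemma Itl_itv p (i : 'I_p) : 2^-1 <= (Itl p : 'M[R]_p) i i <= 1.
Proof. by rewrite mxE eqxx; case: ifP => _; lra. Qed.

Lemma nneg_diag_Itl p : nneg_diag (Itl p : 'M[R]_p).
Proof.
split; first exact: is_diag_mx_Itl.
by move=> i; have := Itl_itv i; lra.
Qed.

Lemma nneg_diag_tens {p q} (A : 'M[R]_p) (B : 'M[R]_q) :
  nneg_diag A -> nneg_diag B -> nneg_diag (tensmx A B).
Proof.
move=> [dA A0] [dB B0]; split; first exact: is_diag_mx_tens.
by move=> i; rewrite mxE mulr_ge0.
Qed.

Lemma nneg_diag_bdiag {p q} (A : 'M[R]_p) (B : 'M[R]_q) :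
  nneg_diag A -> nneg_diag B -> nneg_diag (bdiag A B).
Proof.
move=> [dA A0] [dB B0]; split.
  by rewrite /bdiag is_diag_block_mx // !eqxx dA dB.
move=> i; rewrite -(splitK i); case: (split i) => j /=.
  by rewrite block_mxEul.
by rewrite block_mxEdr.
Qed.

Lemma diag_mulmxE {p q} (A : 'M[R]_p) (B : 'M[R]_(p, q)) i j :
  is_diag_mx A -> (A *m B) i j = A i i * B i j.
Proof.
move=> /is_diag_mxP dA; rewrite mxE (bigD1 i) //= big1 ?addr0 // => k ki.
by rewrite dA ?mul0r // eq_sym.
Qed.

Lemma nneg_diagM {p} (A B : 'M[R]_p) :
  nneg_diag A -> nneg_diag B -> nneg_diag (A *m B).
Proof.
move=> [dA A0] [dB B0]; split.
  apply/is_diag_mxP => i j ij; rewrite diag_mulmxE //.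
  by move/is_diag_mxP: dB => ->; rewrite ?mulr0.
by move=> i; rewrite diag_mulmxE // mulr_ge0.
Qed.

Lemma nneg_diag_invmx {p} (A : 'M[R]_p) : nneg_diag A -> nneg_diag (invmx A).
Proof.
move=> [dA A0]; have [Au|An] := boolP (A \in unitmx); last first.
  (* By convention [invmx] returns a singular matrix unchanged. *)
  by rewrite /invmx (negPf An); split.
have AV i j : A i i * invmx A i j = (i == j)%:R.
  by rewrite -diag_mulmxE // mulmxV // mxE.
have Aneq0 i : A i i != 0.
  by apply/eqP => Ai; have /eqP := AV i i; rewrite Ai mul0r eqxx eq_sym oner_eq0.
split=> [|i].
  apply/is_diag_mxP => i j ij; apply: (mulfI (Aneq0 i)).
  by rewrite AV mulr0 -val_eqE /= (negPf ij).
have := AV i i; rewrite eqxx => AVi.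
by rewrite -(pmulr_rge0 _ (_ : 0 < A i i)) ?AVi ?ler01 // lt_def Aneq0 A0.
Qed.

Lemma is_diag_trmxE {p} (A : 'M[R]_p) : is_diag_mx A -> A^T = A.
Proof.
move=> /is_diag_mxP dA; apply/matrixP => i j; rewrite mxE.
by have [->//|ij] := eqVneq i j; rewrite !dA // eq_sym.
Qed.

Lemma bform_diag {p} (A : 'M[R]_p) x y : is_diag_mx A ->
  bform x A y = \sum_i A i i * (x i ord0 * y i ord0).
Proof.
move=> dA; rewrite /bform -mulmxA mxE; apply: eq_bigr => i _.
by rewrite diag_mulmxE // mxE mulrCA.
Qed.

Lemma bform_nneg_diag_ge0 {p} (A : 'M[R]_p) x : nneg_diag A -> 0 <= bform x A x.
Proof.
move=> [dA A0]; rewrite bform_diag //; apply: sumr_ge0 => i _.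
by rewrite mulr_ge0 // -expr2 sqr_ge0.
Qed.

End DiagonalMatrices.

(** * The FDTD-Q scheme *)

Section Scheme.
Variables (R : realType) (hbar m dx dy dz dt : R) (nx ny nz : nat).
Variable U : 'cV[R]_(Nn nx ny nz).
Hypotheses (hbar_gt0 : 0 < hbar) (m_gt0 : 0 < m) (dx_gt0 : 0 < dx)
  (dy_gt0 : 0 < dy) (dz_gt0 : 0 < dz) (dt_gt0 : 0 < dt).

Local Notation V := (DVpp nx ny nz dx dy dz).
Local Notation H := (Hmx nx ny nz hbar m dx dy dz U).
Local Notation P := (Pmx nx ny nz hbar m dx dy dz dt U).
Local Notation cell := (dx * dy * dz).
Local Notation Umin := (\big[Num.min/0]_(i < Nn nx ny nz) U i ord0).

Let cell_gt0 : 0 < cell.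
Proof. by rewrite !mulr_gt0. Qed.

Lemma DVpp_diag : is_diag_mx V.
Proof.
apply: is_diag_mxZ; apply: is_diag_mx_tens; first exact: is_diag_mx_Itl.
by apply: is_diag_mx_tens; exact: is_diag_mx_Itl.
Qed.

(** Each of the three Kronecker factors has its diagonal entries in [1/2, 1], whence the 1/8. *)
Lemma DVpp_itv i : cell / 8 <= V i i <= cell.
Proof.
rewrite /DVpp mxE -(mxtens_unindexK i); case: (mxtens_unindex i) => i1 j.
rewrite -(mxtens_unindexK j); case: (mxtens_unindex j) => i2 i3; rewrite !tensmxE.
have /andP[a1 a2] := Itl_itv R i1; have /andP[b1 b2] := Itl_itv R i2.
have /andP[c1 c2] := Itl_itv R i3; have half : 0 <= 2^-1 :> R by rewrite invr_ge0.
set t := Itl nz.+1 i1 i1 * (Itl ny.+1 i2 i2 * Itl nx.+1 i3 i3).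
have le1 : 2^-1 * (2^-1 * 2^-1) <= t.
  by rewrite !ler_pM // mulr_ge0.
have le2 : t <= 1.
  have ge0 := le_trans half.
  by rewrite mulr_ile1 ?mulr_ge0 ?ge0 // mulr_ile1 ?ge0.
by rewrite ler_wpM2l ?ler_piMr ?(ltW cell_gt0) // (le_trans _ le1) //; lra.
Qed.

Lemma DVpp_gt0 i : 0 < V i i.
Proof. by have /andP[h _] := DVpp_itv i; apply: lt_le_trans h; rewrite divr_gt0. Qed.

Lemma bform_DVpp_le x : bform x V x <= cell * sqnorm x.
Proof.
rewrite bform_diag ?DVpp_diag // mulr_sumr; apply: ler_sum => i _.
by rewrite -expr2 ler_wpM2r ?sqr_ge0 //; case/andP: (DVpp_itv i).
Qed.

Lemma bform_DVpp_ge x : cell / 8 * sqnorm x <= bform x V x.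
Proof.
rewrite bform_diag ?DVpp_diag // mulr_sumr; apply: ler_sum => i _.
by rewrite -expr2 ler_wpM2r ?sqr_ge0 //; case/andP: (DVpp_itv i).
Qed.

Lemma bform_DVpp_ge0 x : 0 <= bform x V x.
Proof.
apply: le_trans (bform_DVpp_ge x); rewrite mulr_ge0 ?sqnorm_ge0 //.
by rewrite divr_ge0 // ltW.
Qed.

Lemma bform_DVpp_sym x y : bform x V y = bform y V x.
Proof. by rewrite bformT is_diag_trmxE ?DVpp_diag. Qed.

Lemma bform_DVpp_AMGM x y :
  - (bform x V x + bform y V y) <= 2 * bform x V y.
Proof.
have := bform_DVpp_ge0 (x + y); rewrite !bformE (bform_DVpp_sym y x); lra.
Qed.

Lemma bform_DVpp_parallelogram x y :
  bform (x - y) V (x - y) <= 2 * (bform x V x + bform y V y).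
Proof.
have := bform_DVpp_ge0 (x + y); rewrite !bformE (bform_DVpp_sym y x); lra.
Qed.

(** * Symmetry of [H] and its lower bound *)

Let W := DSpp nx ny nz dx dy dz *m invmx (Dlp nx ny nz dx dy dz).

(** [W] holds the ratios of face areas to edge lengths; its nonnegativity makes the kinetic part of
    [H] symmetric and positive semidefinite. *)
Lemma nneg_diag_kinetic_weight : nneg_diag W.
Proof.
have It p : nneg_diag (Itl p : 'M[R]_p) := nneg_diag_Itl R p.
have I1 p : nneg_diag (1%:M : 'M[R]_p) := nneg_diag1 R p.
have [dx0 dy0 dz0] := And3 (ltW dx_gt0) (ltW dy_gt0) (ltW dz_gt0).
apply: nneg_diagM; last apply: nneg_diag_invmx.
  rewrite /DSpp; apply: nneg_diag_bdiag; last apply: nneg_diag_bdiag.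
  - by apply: nneg_diagZ (mulr_ge0 dy0 dz0)
      (nneg_diag_tens (It _) (nneg_diag_tens (It _) (I1 _))).
  - by apply: nneg_diagZ (mulr_ge0 dx0 dz0)
      (nneg_diag_tens (It _) (nneg_diag_tens (I1 _) (It _))).
  - by apply: nneg_diagZ (mulr_ge0 dx0 dy0)
      (nneg_diag_tens (I1 _) (nneg_diag_tens (It _) (It _))).
rewrite /Dlp; apply: nneg_diag_bdiag; last apply: nneg_diag_bdiag.
- by apply: nneg_diagZ dx0 (I1 _).
- by apply: nneg_diagZ dy0 (I1 _).
- by apply: nneg_diagZ dz0 (I1 _).
Qed.

Lemma Hmx_split : H = (hbar ^+ 2 / (2 * m)) *: (Dmx nx ny nz *m W *m (Dmx nx ny nz)^T)
  + V *m DUmx U.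
Proof. by rewrite /Hmx /W !mulmxA. Qed.

Lemma Hmx_sym : H^T = H.
Proof.
have congr_sym q r (D : 'M[R]_(q, r)) B : B^T = B ->
    (D *m B *m D^T)^T = D *m B *m D^T.
  by move=> BT; rewrite !trmx_mul trmxK BT mulmxA.
rewrite Hmx_split linearD linearZ /= congr_sym; last first.
  exact: is_diag_trmxE nneg_diag_kinetic_weight.1.
rewrite trmx_mul /DUmx tr_diag_mx (is_diag_trmxE DVpp_diag).
(* The potential part is symmetric because diagonal matrices commute. *)
by have /diag_mxP[d ->] := DVpp_diag; rewrite diag_mxC.
Qed.

Lemma bform_Hmx_sym x y : bform x H y = bform y H x.
Proof. by rewrite bformT Hmx_sym. Qed.

(** The kinetic part only adds to the form. In the potential part, [U i ord0] is lowered to [Umin],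
    and then the weight [V i i] is raised to [cell], which lowers the product because
    [Umin <= 0]. *)
Lemma bform_Hmx_ge x : cell * Umin * sqnorm x <= bform x H x.
Proof.
have Umin0 : Umin <= 0 by exact: bigmin_le_id.
rewrite Hmx_split bformDm bformZm bform_mul bform_mulT.
apply: ler_wpDl.
  rewrite mulr_ge0 ?bform_nneg_diag_ge0 //; last exact: nneg_diag_kinetic_weight.
  by rewrite divr_ge0 ?sqr_ge0 // mulr_ge0 // ltW.
rewrite bform_mul bform_diag ?DVpp_diag // mulr_sumr; apply: ler_sum => i _.
rewrite /DUmx diag_mulmxE ?diag_mx_is_diag //.
have -> : diag_mx U^T i i = U i ord0 by rewrite !mxE eqxx mulr1n.
have Ui : Umin <= U i ord0 by exact: bigmin_le.
have xx := sqr_ge0 (x i ord0).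
have /andP[_ Vi] := DVpp_itv i; have Vi0 := DVpp_gt0 i.
rewrite [leRHS](_ : _ = V i i * U i ord0 * x i ord0 ^+ 2); last ring.
by rewrite ler_wpM2r //; nra.
Qed.

(** * Upper bound on [H] through the spectral radius *)

Let T := diag_inv_sqrt V.
Let A := hbar^-1 *: (T *m H *m T).

Lemma diag_inv_sqrt_diag : is_diag_mx T.
Proof. by apply/is_diag_mxP => i j ij; rewrite mxE -val_eqE /= (negPf ij). Qed.

(** The witness is the square root of [V] applied to [x]: this change of variable trades the
    [V]-norm for the Euclidean one. *)
Lemma diag_inv_sqrtP x : exists2 u, T *m u = x & sqnorm u = bform x V x.
Proof.
exists (\col_i (Num.sqrt (V i i) * x i ord0)).
  apply/colP => i; rewrite diag_mulmxE ?diag_inv_sqrt_diag // [T i i]mxE.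
  by rewrite [(\col__ _) i _]mxE eqxx mulKf // gt_eqF // sqrtr_gt0 DVpp_gt0.
rewrite bform_diag ?DVpp_diag //; apply: eq_bigr => i _.
by rewrite [X in X ^+ 2]mxE exprMn (sqr_sqrtr (ltW (DVpp_gt0 i))) expr2.
Qed.

(** In the variables [u] and [w], the form of [H] becomes [hbar] times that of [A], to which the
    spectral bound applies. *)
Lemma bform_Hmx_le x y :
  2 * bform x H y <= hbar * specrad A * (bform x V x + bform y V y).
Proof.
have [u <- <-] := diag_inv_sqrtP x; have [w <- <-] := diag_inv_sqrtP y.
have Asym : A^T = A.
  by rewrite /A linearZ /= !trmx_mul Hmx_sym (is_diag_trmxE diag_inv_sqrt_diag) mulmxA.
have -> : bform (T *m u) H (T *m w) = hbar * bform u A w.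
  rewrite /A bformZm mulVKf ?gt_eqF // bform_mul bform_mulT.
  by rewrite (is_diag_trmxE diag_inv_sqrt_diag).
rewrite mulrCA -mulrA ler_pM2l //; exact: sym_bform_le_specrad.
Qed.

Lemma bform_Pmx x y : bform (col_mx x y) P (col_mx x y) =
  bform x V x + bform y V y - dt / hbar * bform x H y.
Proof.
rewrite /Pmx bform_block !bformZm (bform_Hmx_sym y x); field.
by rewrite gt_eqF.
Qed.

Lemma Pmx_sym : P^T = P.
Proof.
have cH_sym c : (c *: H)^T = c *: H by rewrite linearZ /= Hmx_sym.
by rewrite /Pmx tr_block_mx !cH_sym (is_diag_trmxE DVpp_diag).
Qed.

(** * Positive definiteness of [P] under the CFL condition *)

Hypothesis CFL : dt < 2 / specrad A.

(** The off-diagonal blocks take away at most the fraction [dt * specrad A / 2] of the diagonal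
    ones, and CFL makes this fraction less than 1. The witness is the remaining fraction times the
    lower bound [cell / 8] on [V]. *)
Lemma Pmx_coercive : exists2 delta, 0 < delta &
  forall z, delta * sqnorm z <= bform z P z.
Proof.
(* [specrad A = 0] is excluded, since then [CFL] reads [dt < 2 / 0 = 0]. *)
have rho_gt0 : 0 < specrad A.
  by move: (lt_trans dt_gt0 CFL); rewrite pmulr_rgt0 ?invr_gt0 ?ltr0n.
have gap : 0 < 1 - dt * specrad A / 2.
  by move: CFL; rewrite ltr_pdivlMr // => h; lra.
exists ((1 - dt * specrad A / 2) * (cell / 8)).
  by rewrite mulr_gt0 // divr_gt0.
move=> z; rewrite -[z]vsubmxK; set x := usubmx z; set y := dsubmx z.
rewrite sqnorm_col_mx bform_Pmx -mulrA mulrDr.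
have hxy : dt / hbar * bform x H y <=
    dt * specrad A / 2 * (bform x V x + bform y V y).
  have c_ge0 : 0 <= dt / (2 * hbar) by rewrite divr_ge0 ?mulr_ge0 ?ltW.
  have /(ler_wpM2l c_ge0) := bform_Hmx_le x y.
  have -> : dt / (2 * hbar) * (2 * bform x H y) = dt / hbar * bform x H y.
    by field; rewrite gt_eqF.
  suff -> : dt * specrad A / 2 = dt / (2 * hbar) * (hbar * specrad A).
    by rewrite !mulrA.
  by field; rewrite gt_eqF.
have := lerD (bform_DVpp_ge x) (bform_DVpp_ge y) => /(ler_wpM2l (ltW gap)).
lra.
Qed.

Lemma lambda_min_Pmx_gt0 : 0 < lambda_min P.
Proof.
have [delta delta_gt0 Pdelta] := Pmx_coercive.
apply: lt_le_trans delta_gt0 _; apply: lambda_min_ge Pdelta.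
  exact: Pmx_sym.
by rewrite /Nn.
Qed.

Lemma sqnorm_le_Pmx x y Pmax : bform (col_mx x y) P (col_mx x y) <= Pmax ->
  sqnorm x + sqnorm y <= Pmax / lambda_min P.
Proof.
move=> le_Pmax; rewrite ler_pdivlMr ?lambda_min_Pmx_gt0 // mulrC.
have [delta _ Pdelta] := Pmx_coercive.
rewrite -sqnorm_col_mx; apply: le_trans le_Pmax.
exact: lambda_min_le Pmx_sym _ _ Pdelta.
Qed.

(** * Lower bound on the total energy *)

Variables (psiR psiI : nat -> 'cV[R]_(Nn nx ny nz)) (Pmax : R).

Lemma total_energyE n :
  total_energy nx ny nz hbar m dx dy dz dt U psiR psiI n =
  bform (psiR n) H (psiR n) + bform (psiI n) H (psiI n)
  + hbar / dt * bform (psiR n - psiR n.-1) V (psiI n.+1 - psiI n).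
Proof.
rewrite /total_energy -/(bform _ _ _) -/(bform _ _ _) -/(bform _ _ _).
by rewrite bformZl bformZm bformZr; field; rewrite gt_eqF.
Qed.

(** The probability bound is required up to [n.+1] because the mixed term contains [psiI n.+1]. *)
Lemma total_energy_ge n :
  (forall k, (k <= n.+1)%N ->
    total_prob nx ny nz hbar m dx dy dz dt U psiR psiI k <= Pmax) ->
  cell * (Pmax / lambda_min P) * (Umin - 4 * hbar / dt)
    <= total_energy nx ny nz hbar m dx dy dz dt U psiR psiI n.
Proof.
move=> prob_le; set Q := Pmax / _.
have Q_ge k : (k <= n.+1)%N -> sqnorm (psiR k) + sqnorm (psiI k) <= Q.
  by move=> /prob_le; exact: sqnorm_le_Pmx.
have Umin0 : Umin <= 0 by exact: bigmin_le_id.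
rewrite total_energyE mulrDr; apply: lerD.
  apply: le_trans (lerD (bform_Hmx_ge _) (bform_Hmx_ge _)).
  (* As [cell * Umin] is nonpositive, the upper bound [Q] on the norms gives a lower bound. *)
  rewrite -mulrDr mulrAC ler_wnM2l ?Q_ge //.
  by rewrite mulr_ge0_le0 // ltW.
set x := psiR n - _; set y := psiI n.+1 - _.
have xV : bform x V x <= 2 * (cell * sqnorm (psiR n) + cell * sqnorm (psiR n.-1)).
  apply: le_trans (bform_DVpp_parallelogram _ _) _.
  by rewrite ler_pM2l // lerD // bform_DVpp_le.
have yV : bform y V y <= 2 * (cell * sqnorm (psiI n.+1) + cell * sqnorm (psiI n)).
  apply: le_trans (bform_DVpp_parallelogram _ _) _.
  by rewrite ler_pM2l // lerD // bform_DVpp_le.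
have xyV := bform_DVpp_AMGM x y.
have cQ k : (k <= n.+1)%N ->
    cell * sqnorm (psiR k) + cell * sqnorm (psiI k) <= cell * Q.
  by move=> /Q_ge; rewrite -mulrDr ler_pM2l.
have q0 := cQ n (leqnSn n); have q1 := cQ n.+1 (leqnn _).
have q2 := cQ n.-1 (leq_trans (leq_pred n) (leqnSn n)).
have cn_ge0 p (z : 'cV[R]_p) : 0 <= cell * sqnorm z.
  by rewrite mulr_ge0 ?sqnorm_ge0 // ltW.
have := cn_ge0 _ (psiR n.+1); have := cn_ge0 _ (psiI n.-1).
have := cn_ge0 _ (psiR n.-1); have := cn_ge0 _ (psiI n.+1).
have hdt : 0 < hbar / dt by rewrite divr_gt0.
(* The constant 4: AM-GM and the two parallelogram bounds leave the squared norms of [psiR n],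
   [psiR n.-1], [psiI n.+1] and [psiI n], each at most [Q]. *)
rewrite (_ : _ * - _ = hbar / dt * (- 4 * (cell * Q))); last by rewrite /Q; ring.
rewrite ler_pM2l //.
have := cn_ge0 _ (psiR n); have := cn_ge0 _ (psiI n); lra.
Qed.

(** * Power balance *)

Variables (gR gI : nat -> 'cV[R]_(Mb nx ny nz)) (nt : nat).
Hypothesis scheme : fdtdq_scheme nx ny nz nt hbar m dx dy dz dt U psiR psiI gR gI.
Local Notation G := (Hperp nx ny nz hbar m dx dy dz).

Lemma scheme_bformR n z : (n < nt)%N ->
  hbar / dt * bform z V (psiR n.+1 - psiR n)
  = bform z H (psiI n.+1) - bform z G (gI n).
Proof.
move=> /scheme[+ _] => /(congr1 (fun y => bform z 1%:M y)).
rewrite /= [X in _ = X -> _]bformDr bformNr -!bform_mul !mul1mx bformZm bformZr.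
by rewrite mulrA.
Qed.

Lemma scheme_bformI n z : (n < nt)%N ->
  hbar / dt * bform z V (psiI n.+1 - psiI n)
  = - bform z H (psiR n) + bform z G (gR n).
Proof.
move=> /scheme[_ +] => /(congr1 (fun y => bform z 1%:M y)).
rewrite /= [X in _ = X -> _]bformDr bformNr -!bform_mul !mul1mx bformZm bformZr.
by rewrite mulrA.
Qed.

(** With the increments of [psiR] and [psiI] from [n.+1] to [n.+2] as test vectors, [e1] and [e4]
    remove [V] from the two mixed energy terms. *)
Lemma energy_balance n : (n.+2 < nt)%N ->
  (total_energy nx ny nz hbar m dx dy dz dt U psiR psiI n.+2
    - total_energy nx ny nz hbar m dx dy dz dt U psiR psiI n.+1) / dt
  = supplied_power nx ny nz hbar m dx dy dz dt psiR psiI gR gI n.+1.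
Proof.
move=> ltn.
rewrite !total_energyE /supplied_power -/(bform _ _ _) -/(bform _ _ _) /=.
have e1 := scheme_bformI (psiR n.+2 - psiR n.+1) ltn.
have e2 := scheme_bformI (psiR n.+2 - psiR n.+1) (ltnW ltn).
have e3 := scheme_bformR (psiI n.+2 - psiI n.+1) (ltnW ltn).
have e4 := scheme_bformR (psiI n.+2 - psiI n.+1) (ltnW (ltnW ltn)).
rewrite (bform_DVpp_sym (psiR n.+1 - psiR n)) e1 e4.
(* [e2] and [e3] evaluate the same form of [V] on the two increments. Equating them gives [cross], a
   relation between [H] and boundary terms only, which cancels what remains of [H] in the energy
   difference. *)
move: e2; rewrite bform_DVpp_sym e3 !bformE.
rewrite (bform_Hmx_sym (psiR n.+2) (psiR n.+1)) (bform_Hmx_sym (psiI n.+2) (psiI n.+1)).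
move=> /eqP; rewrite -subr_eq0 => /eqP cross.
apply/eqP; rewrite -subr_eq0 -[X in _ == X](mulr0 dt^-1) -cross; apply/eqP.
by field; rewrite gt_eqF.
Qed.

End Scheme.

Unset Implicit Arguments.

Theorem theorem3 (R : realType) (hbar m dx dy dz dt Pmax : R) (nx ny nz nt : nat)
  (U : 'cV[R]_(Nn nx ny nz))
  (psiR psiI : nat -> 'cV[R]_(Nn nx ny nz))
  (gR gI : nat -> 'cV[R]_(Mb nx ny nz)) :
  0 < hbar -> 0 < m -> 0 < dx -> 0 < dy -> 0 < dz ->
  (0 < nx)%N -> (0 < ny)%N -> (0 < nz)%N -> (0 < nt)%N ->
  0 < dt ->
  dt < 2 / specrad (hbar^-1 *: (diag_inv_sqrt (DVpp nx ny nz dx dy dz)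
                                 *m Hmx nx ny nz hbar m dx dy dz U
                                 *m diag_inv_sqrt (DVpp nx ny nz dx dy dz))) ->
  fdtdq_scheme nx ny nz nt hbar m dx dy dz dt U psiR psiI gR gI ->
  (forall n : nat, (n <= nt)%N ->
     total_prob nx ny nz hbar m dx dy dz dt U psiR psiI n <= Pmax) ->
  (forall n : nat, (1 <= n <= nt - 1)%N ->
     dx * dy * dz * (Pmax / lambda_min (Pmx nx ny nz hbar m dx dy dz dt U))
       * (\big[Num.min/0]_(i < Nn nx ny nz) U i ord0 - 4 * hbar / dt)
     <= total_energy nx ny nz hbar m dx dy dz dt U psiR psiI n)
  /\
  (forall n : nat, (1 <= n <= nt - 2)%N ->
     (total_energy nx ny nz hbar m dx dy dz dt U psiR psiI n.+1 - total_energy nx ny nz hbar m dx dy dz dt U psiR psiI n) / dt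
       = supplied_power nx ny nz hbar m dx dy dz dt psiR psiI gR gI n).
Proof.
move=> hbar0 m0 dx0 dy0 dz0 _ _ _ nt0 dt0 CFL scheme prob; split=> n /andP[n0 nle].
  apply: total_energy_ge => // k kn; apply: prob.
  by apply: leq_trans kn _; rewrite -(prednK nt0) ltnS -subn1.
(* Writing the index as a successor gives the range of [energy_balance]: [n < nt - 2] means
   [n.+2 < nt]. *)
case: n n0 nle => // n _; rewrite ltn_subRL => nle.
exact: (energy_balance dx0 dy0 dz0 dt0 scheme).
Qed.
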